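(* For every positive integer $n$, the $n\times n$ magog matrices having no entry equal to $-1$ are exactly the permutation matrices of the $132$-avoiding permutations of $\{1,\dots,n\}$.
   Context: An $n\times n$ magog matrix is an $n\times n$ matrix $A=(a_{ij})$ with entries in $\{0,1,-1\}$ such that all row sums and all column sums equal $1$, $0\le \sum_{i'=1}^{i}a_{i'j}\le 1$ for all $1\le i,j\le n$, $\sum_{j'=1}^{j}a_{ij'}\ge 0$ for all $1\le i,j\le n$, and for all $1\le i\le n-2$, $1\le j\le n-2$, $$\sum_{j'=1}^{j}a_{i+1,j'}+\sum_{i'=1}^{i+1}a_{i',j+1}-\sum_{i'=1}^{i}a_{i'j}\ge 0.$$ The permutation matrix of a permutation $\pi=\pi_1\cdots\pi_n$ is the $n\times n$ matrix $M$ with $M_{ij}=1$ if $\pi_i=j$ and $M_{ij}=0$ otherwise. A permutation $\pi$ contains a $132$ pattern if there are indices $i<j<k$ with $\pi_i<\pi_k<\pi_j$; it is $132$-avoiding otherwise. *)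

(* Defs.v *)
From mathcomp Require Import all_boot all_order all_fingroup all_algebra.

Set Implicit Arguments.
Unset Strict Implicit.
Unset Printing Implicit Defensive.

Import Order.TTheory GRing.Theory Num.Theory.
Local Open Scope ring_scope.

(* Rows and columns are indexed from 0: [i : 'I_n] stands for the index
   [i + 1] of the set {1, ..., n}. *)

Section Magog.

Variable n : nat.

Definition row_psum (A : 'M[int]_n) (i j : 'I_n) : int :=
  \sum_(k < n | (k <= j)%N) A i k.

Definition col_psum (A : 'M[int]_n) (i j : 'I_n) : int :=
  \sum_(k < n | (k <= i)%N) A k j.

(* In [magog_ineq] the bounds [i.+2 < n], [j.+2 < n] are 1 <= i, j <= n - 2
   shifted to 0-based indices; under them [ordS] does not wrap around. *)
Record magog (A : 'M[int]_n) : Prop := Magog {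
  magog_entries : forall i j, A i j \in [:: 0; 1; -1];
  magog_row_sum : forall i, \sum_(j < n) A i j = 1;
  magog_col_sum : forall j, \sum_(i < n) A i j = 1;
  magog_col_psum : forall i j, 0 <= col_psum A i j <= 1;
  magog_row_psum : forall i j, 0 <= row_psum A i j;
  magog_ineq : forall i j : 'I_n, (i.+2 < n)%N -> (j.+2 < n)%N ->
    0 <= row_psum A (ordS i) j + col_psum A (ordS i) (ordS j) - col_psum A i j
}.

Definition contains132 (s : 'S_n) : Prop :=
  exists i j k : 'I_n,
    (i < j)%N /\ (j < k)%N /\ (s i < s k)%N /\ (s k < s j)%N.

Definition avoids132 (s : 'S_n) : Prop := ~ contains132 s.

End Magog.

(* Main.v *)
Require Import Defs.
From mathcomp Require Import all_boot all_order all_fingroup all_algebra.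

Import Order.TTheory GRing.Theory Num.Theory.

Local Open Scope ring_scope.

(** Without entries -1, the row and column sums force the permutation matrix of
    some s, whose partial sums are the indicators of s i <= j and of
    s^-1 j <= i. The last magog inequality then fails at (i, j) exactly when
    s^-1 j < i + 1 < s^-1 (j + 1) and j + 1 < s (i + 1), which is a 132 pattern
    with consecutive values j, j + 1 in the roles of 1 and 2. Conversely, given a
    132 pattern at positions a < b < c, the values going up from s a to s c start
    at a position left of b and end at one right of b, so two consecutive ones
    lie on either side of b, and both are below s b. *)

Lemma sum_delta (n : nat) (P : pred 'I_n) (j : 'I_n) :
  \sum_(k < n | P k) ((j == k)%:R : int) = (P j)%:R.
Proof.
rewrite big_mkcond (bigD1 j) //= big1 ?addr0 => [|k /negPf kj].
  by rewrite eqxx; case: (P j).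
by rewrite eq_sym kj if_same.
Qed.

(** Some term is 1, as the sum is not 0. The others are nonnegative with sum 0, so they vanish. *)
Lemma delta_of_sum1 (n : nat) (F : 'I_n -> int) :
  (forall k, F k = 0 \/ F k = 1) -> \sum_(k < n) F k = 1 ->
  exists j, forall k, F k = (j == k)%:R.
Proof.
move=> F01 sumF.
have [j /eqP Fj | F0] := pickP (fun j => F j == 1); last first.
  move: sumF; rewrite big1 // => k _.
  by case: (F01 k) => // Fk; move: (F0 k); rewrite Fk eqxx.
exists j => k; have [<- //|jk] := eqVneq j k.
have F_ge0 i : true && (i != j) -> 0 <= F i by case: (F01 i) => ->.
move: sumF; rewrite (bigD1 j) //= Fj => /eqP.
rewrite -[X in _ == X]addr0 (inj_eq (addrI _)) => /eqP sum0.
by apply: (psumr_eq0P F_ge0 sum0); rewrite eq_sym.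
Qed.

Lemma perm_mx_of_sum1 (n : nat) (A : 'M[int]_n) :
  (forall i j, A i j = 0 \/ A i j = 1) ->
  (forall i, \sum_(j < n) A i j = 1) -> (forall j, \sum_(i < n) A i j = 1) ->
  exists s : 'S_n, A = perm_mx s.
Proof.
move=> A01 rowA colA.
have /fin_all_exists [f Af] i : exists j, forall k, A i k = (j == k)%:R.
  exact: delta_of_sum1.
(* Two rows with the same [f] would put two ones in a single column. *)
have f_inj : injective f.
  move=> i1 i2 f12.
  have [i Ai] := delta_of_sum1 _ _ (A01^~ (f i1)) (colA (f i1)).
  have := Ai i1; have := Ai i2; rewrite !Af -f12 eqxx.
  by case: eqP => // <-; case: eqP.
by exists (perm f_inj); apply/matrixP => i j; rewrite !mxE permE Af.
Qed.

Section PermutationMatrix.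

Variables (n : nat) (s : 'S_n).

Lemma perm_mxE (i j : 'I_n) : (perm_mx s : 'M[int]_n) i j = (s i == j)%:R.
Proof. by rewrite !mxE. Qed.

Lemma perm_mxVE (i j : 'I_n) :
  (perm_mx s : 'M[int]_n) i j = ((s^-1)%g j == i)%:R.
Proof. by rewrite perm_mxE (canF_eq (permK s)) eq_sym. Qed.

Lemma row_psum_perm_mx (i j : 'I_n) :
  row_psum (perm_mx s) i j = (s i <= j)%N%:R.
Proof.
rewrite -(sum_delta _ (fun k : 'I_n => (k <= j)%N)).
by apply: eq_bigr => k _; rewrite perm_mxE.
Qed.

Lemma col_psum_perm_mx (i j : 'I_n) :
  col_psum (perm_mx s) i j = ((s^-1)%g j <= i)%N%:R.
Proof.
rewrite -(sum_delta _ (fun k : 'I_n => (k <= i)%N)).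
by apply: eq_bigr => k _; rewrite perm_mxVE.
Qed.

(** All three partial sums are 0 or 1, so the expression is negative only for 0 + 0 - 1. *)
Lemma magog_ineq_perm_mx (i j : 'I_n) :
  (0 <= row_psum (perm_mx s) (ordS i) j + col_psum (perm_mx s) (ordS i) (ordS j)
        - col_psum (perm_mx s) i j) =
  [|| s (ordS i) <= j, (s^-1)%g (ordS j) <= ordS i | i < (s^-1)%g j]%N.
Proof.
rewrite row_psum_perm_mx !col_psum_perm_mx [(i < _)%N]ltnNge.
by do 3!case: leq.
Qed.

End PermutationMatrix.

Lemma val_ordS_small {n : nat} (i : 'I_n) : (i.+1 < n)%N -> ordS i = i.+1 :> nat.
Proof. exact: modn_small. Qed.

Lemma contains132_consecutive (n : nat) (s : 'S_n) :
  contains132 s -> exists b j j' : 'I_n,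
  [/\ j' = j.+1 :> nat, (s^-1)%g j < b, b < (s^-1)%g j' & j' < s b]%N.
Proof.
case=> a [b [c [ab [bc [ac cb]]]]].
(* [m] is the least value above [s a] placed at or after position [b]. *)
pose P m := (s a < m)%N && [exists k : 'I_n, (s k == m :> nat) && (b <= k)%N].
have exP : exists m, P m.
  by exists (s c); rewrite /P ac; apply/existsP; exists c; rewrite eqxx ltnW.
case: (ex_minnP exP) => m /andP[am /existsP[k /andP[/eqP km bk]]] m_min.
have mc : (m <= s c)%N.
  by apply: m_min; rewrite /P ac; apply/existsP; exists c; rewrite eqxx ltnW.
(* The least value is positive, being above [s a]. From here on [m] is its predecessor, which serves
   as [j]. *)
case: m => [//|m] in am km m_min mc *.
have m_lt : (m < n)%N by rewrite ltnW // -km.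
exists b, (Ordinal m_lt), (s k); split=> //=.
(* If [m] were placed at or after [b], it would be [s a], against [a < b], or a smaller value
   satisfying [P]. *)
- rewrite ltnNge; apply/negP => bm.
  move: am; rewrite ltnS leq_eqVlt => /orP[/eqP am|am].
    have am' : Ordinal m_lt = s a by apply: val_inj.
    by move: bm; rewrite am' permK leqNgt ab.
  suff: (m < m)%N by rewrite ltnn.
  apply: m_min; rewrite /P am; apply/existsP; exists ((s^-1)%g (Ordinal m_lt)).
  by rewrite permKV eqxx.
- rewrite permK ltn_neqAle bk andbT; apply/eqP => /val_inj bk'.
  by move: (leq_ltn_trans mc cb); rewrite -km bk' ltnn.
- by rewrite km; apply: leq_ltn_trans cb.
Qed.

Lemma magog_ineq_avoids132 (n : nat) (s : 'S_n) :
  (forall i j : 'I_n, (i.+2 < n)%N -> (j.+2 < n)%N ->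
    0 <= row_psum (perm_mx s) (ordS i) j
         + col_psum (perm_mx s) (ordS i) (ordS j) - col_psum (perm_mx s) i j)
  <-> avoids132 s.
Proof.
split=> [ineq /contains132_consecutive [b [j [j' [jj' jb bj' j'b]]]] | av i j i2 j2].
  have b_gt0 : (0 < b)%N by apply: leq_ltn_trans jb.
  (* The inequality is used in row [b - 1], so that [ordS] gives back [b]; the positions on either
     side of [b] keep the indices in range. *)
  have i_lt : (b.-1 < n)%N by apply: leq_ltn_trans (leq_pred _) (ltn_ord b).
  have j2 : (j.+2 < n)%N by rewrite -jj'; apply: leq_ltn_trans j'b (ltn_ord _).
  have i2 : ((Ordinal i_lt).+2 < n)%N.
    by rewrite /= prednK //; apply: leq_ltn_trans bj' (ltn_ord _).
  have Eb : ordS (Ordinal i_lt) = b.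
    by apply: val_inj; rewrite /= prednK // modn_small.
  have Ej : ordS j = j' by apply: val_inj; rewrite /= modn_small ?jj' // ltnW.
  have := ineq _ _ i2 j2; rewrite magog_ineq_perm_mx Eb Ej => /or3P[|| /=].
  - by rewrite leqNgt (leq_trans _ (ltnW j'b)) // jj'.
  - by rewrite leqNgt bj'.
  - by rewrite prednK // leqNgt jb.
rewrite magog_ineq_perm_mx; apply/negPn/negP; rewrite !negb_or -!ltnNge.
case/and3P => ji Sij ij; apply: av.
exists ((s^-1)%g j), (ordS i), ((s^-1)%g (ordS j)).
rewrite !permKV (val_ordS_small j (ltnW j2)) ltnSn; do !split=> //.
  by rewrite (val_ordS_small i (ltnW i2)).
(* [ji] only gives [j + 1 <= s (ordS i)]. Equality would place the value [j + 1] at [ordS i],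
   against [Sij]. *)
rewrite ltn_neqAle ji andbT; apply/eqP => jE.
have E : s (ordS i) = ordS j.
  by apply: val_inj; rewrite -[LHS]jE -(val_ordS_small j (ltnW j2)).
by move: Sij; rewrite -E permK ltnn.
Qed.

Theorem theorem3p5 (n : nat) (n_gt0 : (0 < n)%N) (A : 'M[int]_n) :
  (magog A /\ (forall i j : 'I_n, A i j <> -1)) <->
  (exists s : 'S_n, avoids132 s /\ A = perm_mx s).
Proof.
split=> [[[entA rowA colA _ _ ineqA] A_neqN1] | [s [av ->]]].
  have A01 i j : A i j = 0 \/ A i j = 1.
    have := entA i j; rewrite !inE => /or3P[] /eqP; auto.
    by move/A_neqN1.
  have [s defA] := perm_mx_of_sum1 _ _ A01 rowA colA.
  by exists s; split=> //; apply/magog_ineq_avoids132; rewrite -defA.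
split=> [|i j]; last by rewrite perm_mxE; case: eqP.
split=> [i j|i|j|i j|i j|].
- by rewrite perm_mxE; case: eqP.
- under eq_bigr => j _ do rewrite perm_mxE.
  exact: (sum_delta _ predT).
- under eq_bigr => i _ do rewrite perm_mxVE.
  exact: (sum_delta _ predT).
- by rewrite col_psum_perm_mx; case: leq.
- by rewrite row_psum_perm_mx; case: leq.
- exact/magog_ineq_avoids132.
Qed.
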